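(* Let $\Phi=(\varphi_n)_{n\in\mathbb N}$ be a frame for a separable Hilbert space $\mathcal H$, and let $\mathcal A\in B(\mathcal H)$ be such that $\|Id_{\mathcal H}-\mathcal A\|<1$. Then a Bessel sequence $\Phi^{ad}=(\varphi_n^{ad})_{n\in\mathbb N}$ in $\mathcal H$ is an approximately dual frame of $\Phi$ for which $T_\Phi U_{\Phi^{ad}}=\mathcal A$ if and only if there exists $\Theta\in\mathrm{ran}_{B(\mathcal H,\ell^2)}(T_\Phi)$ such that $\varphi_n^{ad}=\mathcal A^*\widetilde\varphi_n+\Theta^*(\delta_n)$ for all $n\in\mathbb N$.
   Context: $\mathcal H$ is a separable Hilbert space, $Id_{\mathcal H}$ the identity operator, $B(\mathcal H)$ (resp. $B(\mathcal H,\ell^2)$) the bounded linear operators from $\mathcal H$ to $\mathcal H$ (resp. $\ell^2$), and $(\delta_n)_n$ the canonical orthonormal basis of $\ell^2$. A sequence $\Phi=(\varphi_n)_{n\in\mathbb N}$ in $\mathcal H$ is a frame if there are constants $m_\Phi,M_\Phi>0$ with $m_\Phi\|f\|^2\le\sum_{n}|\langle f,\varphi_n\rangle|^2\le M_\Phi\|f\|^2$ for all $f\in\mathcal H$; it is a Bessel sequence with Bessel bound $M_\Phi$ if the second inequality holds. For a Bessel sequence $\Phi$: the analysis operator is $U_\Phi:\mathcal H\to\ell^2$, $U_\Phi f=(\langle f,\varphi_n\rangle)_n$; the synthesis operator is $T_\Phi:\ell^2\to\mathcal H$, $T_\Phi((c_n)_n)=\sum_n c_n\varphi_n$; the frame operator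 is $S_\Phi=T_\Phi U_\Phi$, which is invertible when $\Phi$ is a frame, and then $\widetilde\varphi_n:=S_\Phi^{-1}\varphi_n$ defines the canonical dual frame. Two Bessel sequences $\Phi,\Phi^{ad}$ are approximately dual frames if $\|Id_{\mathcal H}-T_\Phi U_{\Phi^{ad}}\|<1$ or $\|Id_{\mathcal H}-T_{\Phi^{ad}} U_\Phi\|<1$ (equivalent conditions, by taking adjoints). Set $\mathrm{ran}_{B(\mathcal H,\ell^2)}(T_\Phi):=\{\Theta\in B(\mathcal H,\ell^2): T_\Phi\Theta=0\}$. *)

(* Defs.v *)
From HB Require Import structures.
From mathcomp Require Import all_boot all_order all_algebra.
From mathcomp Require Import complex.
From mathcomp Require Import all_classical all_reals all_analysis.
From mathcomp Require Import ring lra.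

Set Implicit Arguments.
Unset Strict Implicit.
Unset Printing Implicit Defensive.

Import Order.TTheory GRing.Theory Num.Theory.
Import numFieldNormedType.Exports.

Local Open Scope classical_set_scope.
Local Open Scope ring_scope.

(* A {dot V for Num.conj} is linear in its first argument and conjugate-linear
   in the second. *)
HB.mixin Record NormedModule_hasInnerProduct (R : realType) V
    of NormedModule R[i] V := {
  inner : {dot V for Num.conj} ;
  sqr_norm_inner : forall u : V, `|u| ^+ 2 = inner u u
}.

#[short(type="preHilbertType")]
HB.structure Definition PreHilbert (R : realType) :=
  {V of NormedModule R[i] V & NormedModule_hasInnerProduct R V}.

#[short(type="hilbertType")]
HB.structure Definition Hilbert (R : realType) :=
  {V of PreHilbert R V & Complete V}.

(* `|x| lives in R[i]; nrm x is the same number in R *)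
Definition nrm (R : realType) (V : normedZmodType R[i]) (x : V) : R :=
  complex.Re `|x|.

Section DotNorm.
Variables (C : numClosedFieldType) (U : lmodType C) (form : {dot U for Num.conj}).

Lemma dot_CauchySchwarz (u v : U) :
  `|form u v| ^+ 2 <= form u u * form v v.
Proof.
have [->|v0] := eqVneq v 0.
  by rewrite !linear0r normr0 expr0n.
have vv : 0 < form v v by rewrite neq0_dnorm_gt0.
set a := form u v / form v v.
have ou : form (u - a *: v) v = 0.
  by rewrite linearBl/= linearZl_LR/= divfK ?subrr ?gt_eqF.
have := dnorm_ge0 form (u - a *: v).
rewrite [X in 0 <= X](_ : _ = form u u - `|form u v| ^+ 2 / form v v).
  by rewrite subr_ge0 ler_pdivrMr.
rewrite [LHS]linearBr/= linearZr_LR/= ou mulr0 subr0.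
rewrite linearBl/= linearZl_LR/= normCK /a (hermC form v u) expr0 mul1r.
by rewrite mulrAC.
Qed.

Lemma dot_triangle (u v : U) :
  sqrtC (form (u + v) (u + v)) <= sqrtC (form u u) + sqrtC (form v v).
Proof.
have s0 w : 0 <= sqrtC (form w w) by rewrite sqrtC_ge0 dnorm_ge0.
rewrite -(@ler_pXn2r _ 2) ?nnegrE ?addr_ge0 //.
rewrite sqrrD !sqrtCK dnormD [leRHS]addrAC lerD2l.
have cs : `|form u v| <= sqrtC (form u u) * sqrtC (form v v).
  rewrite -(@ler_pXn2r _ 2) ?nnegrE ?mulr_ge0 // exprMn !sqrtCK.
  exact: dot_CauchySchwarz.
apply: (@le_trans _ _ (`|form u v| *+ 2)); last by rewrite lerMn2r cs.
have -> : form u v + (form u v)^* = 'Re (form u v) *+ 2.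
  by rewrite ReE -mulr_natr divfK ?pnatr_eq0.
rewrite lerMn2r /=.
have := leif_Re_Creal (form u v).
by case.
Qed.

End DotNorm.

Lemma lim_series_linear (K : numFieldType) (V : normedModType K) (k : K)
    (f g : nat -> V) : cvgn (series f) -> cvgn (series g) ->
  limn (series (fun n => k *: f n + g n)) =
  k *: limn (series f) + limn (series g).
Proof.
move=> cf cg; apply/cvg_lim; first exact: norm_hausdorff.
rewrite (_ : series _ = (fun n => k *: series f n + series g n)).
  by apply: cvgD => //; apply: cvgZ => //; exact: cvg_cst.
by apply/funext => n; rewrite /series/= scaler_sumr -big_split.
Qed.

Section Ell2.
Variable R : realType.
Local Notation C := R[i].

Lemma nrmC (V : normedZmodType C) (x : V) : ((nrm x)%:C)%C = `|x|.
Proof. by rewrite /nrm RRe_real ?normr_real. Qed.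

Lemma nrm_ge0 (V : normedZmodType C) (x : V) : 0 <= nrm x.
Proof. by rewrite -ler0c nrmC. Qed.

Lemma nrmD (V : normedZmodType C) (x y : V) : nrm (x + y) <= nrm x + nrm y.
Proof. by rewrite -lecR rmorphD/= !nrmC ler_normD. Qed.

Lemma nrmM (x y : C) : nrm (x * y) = nrm x * nrm y.
Proof. by apply: complexI; rewrite rmorphM/= !nrmC normrM. Qed.

Lemma nrm_conj (x : C) : nrm x^* = nrm x.
Proof. by apply: complexI; rewrite !nrmC norm_conjC. Qed.

Lemma nrm_Re (x : C) : `|complex.Re x| <= nrm x.
Proof. by rewrite -lecR nrmC normc_ge_Re. Qed.

Lemma nrm_Im (x : C) : `|complex.Im x| <= nrm x.
Proof.
have := nrm_Re (x * 'i%C).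
have i1 : nrm ('i%C : C) = 1.
  by rewrite /nrm normc_def /= expr0n/= expr1n add0r sqrtr1.
by rewrite ReiNIm normrN nrmM i1 mulr1.
Qed.

Definition sqsummable : {pred (nat -> C^o)} :=
  fun a => `[< cvgn (series (fun n => nrm (a n) ^+ 2)) >].

Lemma sqsummable_submod_closed : submod_closed sqsummable.
Proof.
split.
  apply/asboolP; rewrite (_ : series _ = fun=> 0); first exact: is_cvg_cst.
  apply/funext => n; rewrite /series/= big1// => i _.
  by rewrite /nrm normr0/= expr0n.
move=> k a b /asboolP ca /asboolP cb; apply/asboolP.
apply: (@series_le_cvg _ _
  (fun n => 2 * nrm k ^+ 2 * nrm (a n) ^+ 2 + 2 * nrm (b n) ^+ 2)).
- by move=> n; rewrite sqr_ge0.
- by move=> n; rewrite -mulrA -exprMn addr_ge0// mulr_ge0// sqr_ge0.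
- move=> n.
  have h1 : nrm (k * a n + b n : C) <= nrm k * nrm (a n : C) + nrm (b n : C).
    by rewrite -nrmM nrmD.
  have := sqr_ge0 (nrm k * nrm (a n : C) - nrm (b n : C)).
  have := nrm_ge0 (k * a n + b n : C).
  move: h1; rewrite -[(k *: a + b) n]/(k * a n + b n).
  move: (nrm (k * _ + _)) (nrm k) (nrm (a n : C)) (nrm (b n : C)) => x y z t.
  move=> xle x0 yzt.
  have x2 : x ^+ 2 <= (y * z + t) ^+ 2.
    by rewrite ler_pXn2r// nnegrE (le_trans x0).
  apply: (le_trans x2); rewrite -subr_ge0.
  rewrite (_ : _ - _ = (y * z - t) ^+ 2)//; ring.
- have -> : (fun n => 2 * nrm k ^+ 2 * nrm (a n) ^+ 2 + 2 * nrm (b n) ^+ 2)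
    = (2 * nrm k ^+ 2) *: (fun n => nrm (a n) ^+ 2)
      + 2 *: (fun n => nrm (b n) ^+ 2) by [].
  by apply: is_cvg_seriesD; exact: is_cvg_seriesZ.
Qed.

HB.instance Definition _ := GRing.isSubmodClosed.Build C (nat -> C^o)
  sqsummable sqsummable_submod_closed.

Record ell2 := Ell2 {
  ell2_seq :> nat -> C^o ;
  ell2_sqsummable : ell2_seq \in sqsummable
}.

HB.instance Definition _ := [isSub for ell2_seq].
HB.instance Definition _ := gen_eqMixin ell2.
HB.instance Definition _ := [Choice of ell2 by <:].
HB.instance Definition _ := [SubChoice_isSubLmodule of ell2 by <:].

Lemma cvg_Complex (x y : R ^nat) (l m : R) :
  x @ \oo --> l -> y @ \oo --> m ->
  (fun n => Complex (x n) (y n) : C^o) @ \oo --> (Complex l m : C^o).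
Proof.
move=> xl ym; apply/cvgrPdist_lt => e e0.
have {}e0 : 0 < complex.Re e /\ e = ((complex.Re e)%:C)%C.
  by case: e e0 => a b; rewrite ltcE/= => /andP[/eqP -> ->].
case: e0 => e0 ->.
have e20 : 0 < complex.Re e / 2 by rewrite divr_gt0.
move/cvgrPdist_lt : xl => /(_ _ e20) xl.
move/cvgrPdist_lt : ym => /(_ _ e20) ym.
near=> n.
have hx : `|l - x n| < complex.Re e / 2 by near: n.
have hy : `|m - y n| < complex.Re e / 2 by near: n.
rewrite -[X in `|X|]/(Complex (l - x n) (m - y n)) normc_def/= ltcR.
have e00 : complex.Re e = Num.sqrt (complex.Re e ^+ 2).
  by rewrite sqrtr_sqr ger0_norm// ltW.
rewrite e00 ltr_sqrt ?exprn_gt0//.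
move: hx hy; rewrite !ltr_norml => /andP[? ?] /andP[? ?]; nra.
Unshelve. all: by end_near. Qed.

Lemma series_Complex (u : nat -> C^o) :
  series u = fun n => Complex (series (fun k => complex.Re (u k)) n)
                              (series (fun k => complex.Im (u k)) n).
Proof.
apply/funext => n; rewrite /series/=.
elim: n => [|n IH]; first by rewrite !big_geq.
by rewrite !big_nat_recr//= IH; case: (u n).
Qed.

Lemma is_cvg_series_complex (u : nat -> C^o) :
  cvgn (series (fun n => nrm (u n : C))) -> cvgn (series u).
Proof.
move=> cu; rewrite series_Complex.
apply/cvg_ex; eexists; apply: cvg_Complex.
- apply: normed_cvg; apply: (series_le_cvg _ _ _ cu) => n.
  + exact: normr_ge0.
  + exact: nrm_ge0.
  + exact: nrm_Re.
- apply: normed_cvg; apply: (series_le_cvg _ _ _ cu) => n.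
  + exact: normr_ge0.
  + exact: nrm_ge0.
  + exact: nrm_Im.
Qed.

Lemma lim_series_conj (u : nat -> C^o) : cvgn (series u) ->
  limn (series (fun n => (u n)^* : C^o)) = (limn (series u))^*.
Proof.
move=> cu; apply/cvg_lim; first exact: norm_hausdorff.
apply/cvgrPdist_lt => e e0; move/cvgrPdist_lt : cu => /(_ e e0).
apply: filterS => n; rewrite -norm_conjC rmorphB /= /series/=.
by rewrite rmorph_sum.
Qed.

Definition ell2_inner (a b : ell2) : C :=
  limn (series (fun n => a n * (b n)^* : C^o)).

Lemma is_cvg_ell2_inner (a b : ell2) :
  cvgn (series (fun n => a n * (b n)^* : C^o)).
Proof.
apply: is_cvg_series_complex.
have /asboolP ca := ell2_sqsummable a; have /asboolP cb := ell2_sqsummable b.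
apply: (@series_le_cvg _ _ (fun n => nrm (a n) ^+ 2 + nrm (b n) ^+ 2)).
- by move=> n; exact: nrm_ge0.
- by move=> n; rewrite addr_ge0 ?sqr_ge0.
- move=> n; rewrite nrmM nrm_conj.
  have := nrm_ge0 (a n : C); have := nrm_ge0 (b n : C).
  move: (nrm (a n : C)) (nrm (b n : C)) => x y ? ?.
  have := sqr_ge0 (x - y); nra.
- exact: (is_cvg_seriesD ca cb).
Qed.

Lemma ell2_inner_conj (a b : ell2) : ell2_inner a b = (ell2_inner b a)^*.
Proof.
rewrite /ell2_inner -lim_series_conj; last exact: is_cvg_ell2_inner.
apply: (congr1 (fun u : nat -> C^o => limn (series u))); apply/funext => n.
by rewrite rmorphM/= conjCK mulrC.
Qed.

Lemma ell2_inner_linearl (c : ell2) k (a b : ell2) :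
  ell2_inner (k *: a + b) c = k * ell2_inner a c + ell2_inner b c.
Proof.
pose f n : C^o := a n * (c n)^*; pose g n : C^o := b n * (c n)^*.
have cf : cvgn (series f) by exact: is_cvg_ell2_inner.
have cg : cvgn (series g) by exact: is_cvg_ell2_inner.
transitivity (limn (series (fun n => k *: f n + g n))).
  apply: (congr1 (fun u : nat -> C^o => limn (series u))); apply/funext => n.
  by rewrite mulrDl -mulrA.
exact: (@lim_series_linear C C^o k f g cf cg).
Qed.

Lemma ell2_inner_linearr (c : ell2) k (a b : ell2) :
  ell2_inner c (k *: a + b) = k^* * ell2_inner c a + ell2_inner c b.
Proof.
rewrite ell2_inner_conj ell2_inner_linearl rmorphD/= rmorphM/=.
by rewrite -!(ell2_inner_conj c).
Qed.

Lemma ell2_inner_gt0 (a : ell2) : a != 0 -> 0 < ell2_inner a a.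
Proof.
move=> a0; have /asboolP ca := ell2_sqsummable a.
have [n an0] : exists n, a n != 0.
  apply: contrapT => /forallNP h; move/eqP : a0; apply.
  apply/val_inj/funext => n /=.
  by apply/eqP/negPn/negP; exact: h.
rewrite /ell2_inner.
have -> : limn (series (fun n => a n * (a n)^* : C^o)) =
    Complex (limn (series (fun n => nrm (a n) ^+ 2))) 0.
  apply/cvg_lim; first exact: norm_hausdorff.
  rewrite series_Complex; apply: cvg_Complex.
    rewrite [X in X @ _ --> _](_ : _ = series (fun n => nrm (a n) ^+ 2)) //.
    congr series; apply/funext => k.
    by rewrite -normCK -nrmC -rmorphXn.
  rewrite [X in X @ _ --> _](_ : _ = fun=> 0); first exact: cvg_cst.
  apply/funext => k; rewrite /series/= big1// => i _.
  by rewrite -normCK -nrmC -rmorphXn.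
rewrite ltcR (@lt_le_trans _ _ (series (fun n => nrm (a n) ^+ 2) n.+1))//.
  rewrite /series/= big_nat_recr//= ltr_wpDl ?sumr_ge0// => [i _|].
    by rewrite sqr_ge0.
  by rewrite exprn_gt0// -ltcR nrmC normr_gt0.
apply: nondecreasing_cvgn_le => //.
by apply: nondecreasing_series => i _ _; rewrite sqr_ge0.
Qed.

HB.instance Definition _ := bilinear_isBilinear.Build C ell2 ell2 C
  (GRing.Scale.Law.clone _ _ *%R _) (GRing.Scale.Law.clone _ _ (Num.conj \; *%R) _)
  ell2_inner (ell2_inner_linearl, ell2_inner_linearr).

Lemma ell2_inner_hermitian (a b : ell2) :
  ell2_inner a b = (-1) ^+ false * (ell2_inner b a)^*.
Proof. by rewrite expr0 mul1r ell2_inner_conj. Qed.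

HB.instance Definition _ := isHermitianSesquilinear.Build C ell2
  false Num.conj ell2_inner ell2_inner_hermitian.

HB.instance Definition _ := isDotProduct.Build C ell2
  ell2_inner ell2_inner_gt0.

Definition ell2_norm (a : ell2) : C := sqrtC (ell2_inner a a).

Lemma ell2_normD (a b : ell2) : ell2_norm (a + b) <= ell2_norm a + ell2_norm b.
Proof. exact: dot_triangle. Qed.

Lemma ell2_normZ (k : C) (a : ell2) : ell2_norm (k *: a) = `|k| * ell2_norm a.
Proof.
rewrite /ell2_norm (dnormZ ell2_inner) sqrtCM ?nnegrE ?exprn_ge0//.
by rewrite (sqrCK (normr_ge0 k)).
Qed.

Lemma ell2_norm_eq0 (a : ell2) : ell2_norm a = 0 -> a = 0.
Proof.
by move=> /eqP; rewrite /ell2_norm sqrtC_eq0 (dnorm_eq0 ell2_inner) => /eqP.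
Qed.

HB.instance Definition _ := Lmodule_isNormed.Build C ell2
  ell2_normD ell2_normZ ell2_norm_eq0.

Lemma ell2_sqr_norm (a : ell2) : `|a| ^+ 2 = ell2_inner a a.
Proof. by rewrite -[`|a|]/(ell2_norm a) sqrtCK. Qed.

HB.instance Definition _ := NormedModule_hasInnerProduct.Build R ell2
  ell2_sqr_norm.

Lemma delta_sqsummable (n : nat) :
  (fun k => (k == n)%:R : C^o) \in sqsummable.
Proof.
apply/asboolP/(nondecreasing_is_cvgn (nondecreasing_series _)) => [k _ _|].
  exact: sqr_ge0.
exists 1 => _ [m _ <-]; rewrite /series/=.
have h k : nrm ((k == n)%:R : C) ^+ 2 = (k == n)%:R.
  by rewrite /nrm; case: (k == n); rewrite ?normr1 ?normr0/= ?expr1n ?expr0n.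
under eq_bigr do rewrite h.
have [nm|nm] := ltnP n m; last first.
  rewrite big_nat big1// => k /andP[_ km].
  by rewrite ltn_eqF// (leq_trans km).
rewrite big_mkord (bigD1 (Ordinal nm))//= eqxx big1 ?addr0// => k kn.
by case: eqP => // e; case/eqP: kn; apply: val_inj.
Qed.

Definition delta (n : nat) : ell2 := Ell2 (delta_sqsummable n).

End Ell2.
Arguments delta {R}.

Definition separable (T : topologicalType) : Prop :=
  exists2 D : set T, countable D & dense D.

Section Operators.
Context (R : realType) (U V : preHilbertType R).

Definition bounded_op : set {linear U -> V} :=
  [set T | exists M : R, forall u, nrm (T u) <= M * nrm u].

(* Taken in \bar R so that an unbounded map has norm +oo. *)
Definition opnorm (T : U -> V) : \bar R :=
  ereal_sup [set (nrm (T u))%:E | u in [set u | nrm u <= 1]].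

(* The vector selected is unique when it exists, since inner is definite; it
   exists when T is a bounded operator and U is complete (Riesz). *)
Definition adjoint (T : U -> V) (v : V) : U :=
  xget 0 [set u | forall x, inner (T x) v = inner x u].

End Operators.

Section Frames.
Context (R : realType) (H : hilbertType R).
Implicit Types Phi Psi : nat -> H.

Local Open Scope ereal_scope.

Definition coef_sqsum Phi (f : H) : \bar R :=
  \sum_(0 <= n <oo) (nrm (inner f (Phi n)) ^+ 2)%:E.

Definition frame Phi : Prop :=
  exists m M : R, [/\ (0 < m)%R, (0 < M)%R &
    forall f, (m * nrm f ^+ 2)%:E <= coef_sqsum Phi f <= (M * nrm f ^+ 2)%:E].

Definition bessel Phi : Prop :=
  exists2 M : R, (0 < M)%R &
    forall f, coef_sqsum Phi f <= (M * nrm f ^+ 2)%:E.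

Local Close Scope ereal_scope.

(* insubd equips the coefficient sequence with the proof that it lies in ell2;
   its default value 0 is never used when Phi is a Bessel sequence, see
   analysisE. *)
Definition analysis Phi (f : H) : ell2 R :=
  insubd 0 (fun n => inner f (Phi n) : R[i]^o).

Lemma analysisE Phi f n : bessel Phi -> analysis Phi f n = inner f (Phi n).
Proof.
move=> [M M0 bM]; rewrite /analysis -[LHS]/(val (insubd _ _) n) insubdK//.
apply/asboolP/(nondecreasing_is_cvgn (nondecreasing_series _)) => [k _ _|].
  exact: sqr_ge0.
exists (M * nrm f ^+ 2) => _ [m _ <-]; rewrite /series/= -lee_fin -sumEFin.
apply: le_trans (bM f); apply: nneseries_lim_ge => k _ _.
by rewrite lee_fin sqr_ge0.
Qed.

Definition synthesis Phi (c : ell2 R) : H :=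
  limn (series (fun n => c n *: Phi n)).

Definition frame_op Phi : H -> H := synthesis Phi \o analysis Phi.

(* 'pinv_ is the inverse function of frame_op Phi, which is bijective when Phi
   is a frame. *)
Definition canonical_dual Phi (n : nat) : H :=
  'pinv_(fun=> 0) [set: H] (frame_op Phi) (Phi n).

Definition approx_dual Phi Psi : Prop :=
  [/\ bessel Phi, bessel Psi &
    (opnorm (fun f : H => f - synthesis Phi (analysis Psi f))%R < 1)%E \/
    (opnorm (fun f : H => f - synthesis Psi (analysis Phi f))%R < 1)%E].

Definition ran_synthesis Phi : set {linear H -> ell2 R} :=
  [set Theta | bounded_op Theta /\ forall f, synthesis Phi (Theta f) = 0].

End Frames.

(* Main.v *)
From HB Require Import structures.
Require Import Defs.
From mathcomp Require Import all_boot all_order all_algebra.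
From mathcomp Require Import complex.
From mathcomp Require Import all_classical all_reals all_analysis.
From mathcomp Require Import ring lra.

(* The frame operator S = T U of Phi is self-adjoint and bounded below, and it
   is onto because 1 - tS is a strict contraction for small t > 0. Adjoints of
   bounded maps on H come from the frame itself: a bounded functional l has
   l(S x) = sum_n <x, Phi n> l(Phi n). The vectors A^* S^-1 Phi n have analysis
   operator U S^-1 A, a lift of A through T, so the operators Theta are exactly
   the differences between the analysis operators of the admissible Phiad and
   this lift. *)

Set Implicit Arguments.
Unset Strict Implicit.
Unset Printing Implicit Defensive.

Import Order.TTheory GRing.Theory Num.Theory.
Import numFieldNormedType.Exports.

Local Open Scope classical_set_scope.
Local Open Scope ring_scope.

(** * The real-valued norm, domination of series, and the Neumann series *)

Section NormedModuleOverC.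
Context (R : realType).
Local Notation C := R[i].

Lemma nrm_sum (W : normedZmodType C) (I : Type) (s : seq I) (P : pred I)
    (u : I -> W) :
  nrm (\sum_(i <- s | P i) u i) <= \sum_(i <- s | P i) nrm (u i).
Proof.
elim/big_rec2 : _ => [|i y x _ yx]; first by rewrite /nrm normr0.
by rewrite (le_trans (nrmD _ _))// lerD2l.
Qed.

Section Nrm.
Context (V : normedModType C).
Implicit Types x y : V.

Lemma nrm0 : nrm (0 : V) = 0.
Proof. by rewrite /nrm normr0. Qed.

Lemma nrmN x : nrm (- x) = nrm x.
Proof. by rewrite /nrm normrN. Qed.

Lemma nrmZ (k : C) x : nrm (k *: x) = nrm k * nrm x.
Proof. by apply: complexI; rewrite rmorphM/= !nrmC normrZ. Qed.

Lemma nrm_eq0 x : (nrm x == 0) = (x == 0).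
Proof. by rewrite -(inj_eq (@complexI R)) nrmC normr_eq0. Qed.

Lemma nrm_realC (a : R) : nrm (a%:C)%C = `|a|.
Proof. by rewrite /nrm normc_def/= expr0n addr0 sqrtr_sqr. Qed.

(** Moves limits from the norm valued in [R[i]] to the real [nrm], where squeezing is available. *)
Lemma cvg_nrmP (u : nat -> V) (l : V) :
  u @ \oo --> l <-> nrm (l - u n) @[n --> \oo] --> (0 : R).
Proof.
split=> [/cvgrPdist_lt ul|/cvgrPdist_lt ul].
  apply/cvgrPdist_lt => e e0.
  have /ul : (0 : C) < (e%:C)%C by rewrite ltcR.
  apply: filterS => n; rewrite -nrmC ltcR.
  by rewrite sub0r normrN ger0_norm ?nrm_ge0.
apply/cvgrPdist_lt => e e0.
(* A positive element of [R[i]] has zero imaginary part. *)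
have [r r0 ->] : exists2 r : R, 0 < r & e = (r%:C)%C.
  by case: e e0 => a b; rewrite ltcE/= => /andP[/eqP -> ?]; exists a.
apply: filterS (ul _ r0) => n.
by rewrite -nrmC ltcR sub0r normrN ger0_norm ?nrm_ge0.
Qed.

End Nrm.

Lemma lipschitz_cvg (V W : normedModType C) (f : V -> W) (K : R)
    (u : nat -> V) (l : V) :
  (forall x y, nrm (f x - f y) <= K * nrm (x - y)) ->
  u @ \oo --> l -> f (u n) @[n --> \oo] --> f l.
Proof.
move=> fK /cvg_nrmP ul; apply/cvg_nrmP.
apply: (@squeeze_cvgr _ _ _ _ (fun=> 0) (fun n => K * nrm (l - u n))).
- by apply: nearW => n; rewrite nrm_ge0 fK.
- exact: cvg_cst.
- by rewrite -[X in _ --> X](mulr0 K); apply: cvgM => //; exact: cvg_cst.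
Qed.

(** Cauchy criterion on blocks of the series. The exponent [p = 1] serves the Neumann series,
    [p = 2] the synthesis series of a Bessel sequence. *)
Lemma series_exp_le_cvg (V : completeNormedModType C) (p : nat) (M : R)
    (u : nat -> V) (s : nat -> R) : (0 < p)%N -> 0 < M ->
  (forall m n, nrm (\sum_(m <= k < n) u k) ^+ p <= M * \sum_(m <= k < n) s k) ->
  cvgn (series s) -> cvgn (series u).
Proof.
move=> p0 M0 us /cauchy_cvgP/cauchy_seriesP cs.
apply/cauchy_cvgP/cauchy_seriesP => e e0.
have [r r0 ->] : exists2 r : R, 0 < r & e = (r%:C)%C.
  by case: e e0 => a b; rewrite ltcE/= => /andP[/eqP -> ?]; exists a.
have rM : 0 < r ^+ p / M by rewrite divr_gt0 ?exprn_gt0.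
apply: filterS (cs _ rM) => -[m n]/= smn.
rewrite -nrmC ltcR -(@ltr_pXn2r _ p) ?nnegrE ?nrm_ge0 ?(ltW r0)//.
rewrite (le_lt_trans (us m n))// mulrC -ltr_pdivlMr//.
exact: le_lt_trans (ler_norm _) smn.
Qed.

(** The solution is the Neumann series of the T^k v, dominated by a geometric series of ratio
    [q]. *)
Lemma sub_contraction_surj (V : completeNormedModType C) (T : {linear V -> V})
    (q : R) : 0 <= q -> q < 1 -> (forall x, nrm (T x) <= q * nrm x) ->
  forall v, exists x, x - T x = v.
Proof.
move=> q0 q1 Tq v.
pose u k := iter k T v.
have uq k : nrm (u k) <= geometric (nrm v) q k.
  elim: k => [|k IH]; first by rewrite /= expr0 mulr1.
  by rewrite (le_trans (Tq _))// (le_trans (ler_wpM2l q0 IH))//= exprS mulrCA.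
have cu : cvgn (series u).
  apply: (@series_exp_le_cvg _ 1 1 u (geometric (nrm v) q)) => // [m n|].
    by rewrite expr1 mul1r (le_trans (nrm_sum _ _ _))// ler_sum.
  by apply: is_cvg_geometric_series; rewrite ger0_norm.
exists (limn (series u)); apply/eqP; rewrite subr_eq; apply/eqP.
have Tlip x y : nrm (T x - T y) <= q * nrm (x - y) by rewrite -linearB.
(* The partial sums satisfy s_(n+1) = v + T s_n; in the limit, x = v + T x. *)
apply: (@cvg_unique _ (@norm_hausdorff _ V) (series u n.+1 @[n --> \oo])).
  by rewrite /= (cvg_shiftS (series u)).
rewrite /= [X in X @ _](_ : _ = fun n => v + T (series u n)).
  by apply: cvgD; [exact: cvg_cst|exact: lipschitz_cvg Tlip cu].
by apply/funext => n; rewrite /series/= big_nat_recl// linear_sum.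
Qed.

End NormedModuleOverC.

(** * The inner product in terms of the real norm *)

Section InnerProduct.
Context (R : realType) (H : preHilbertType R).
Local Notation C := R[i].
Implicit Types u v x : H.

Lemma inner_conj u v : inner u v = (inner v u)^*.
Proof. by rewrite hermC expr0 mul1r. Qed.

Lemma inner_nrm u : inner u u = ((nrm u ^+ 2)%:C)%C.
Proof. by rewrite -sqr_norm_inner rmorphXn/= nrmC. Qed.

Lemma nrm_inner_le u v : nrm (inner u v) <= nrm u * nrm v.
Proof.
rewrite -(@ler_pXn2r _ 2) ?nnegrE ?mulr_ge0 ?nrm_ge0//.
rewrite -lecR rmorphXn/= nrmC exprMn rmorphM/= -!inner_nrm.
exact: dot_CauchySchwarz.
Qed.

Lemma nrmD_sqr u v :
  nrm (u + v) ^+ 2 = nrm u ^+ 2 + nrm v ^+ 2 + 2 * complex.Re (inner u v).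
Proof.
apply: complexI; rewrite -inner_nrm dnormD !inner_nrm.
move: (nrm u ^+ 2) (nrm v ^+ 2) => a b.
by rewrite !rmorphD rmorphM/= rmorph_nat; congr (_ + _); exact: addcJ.
Qed.

Lemma inner_inj u v : (forall x, inner x u = inner x v) -> u = v.
Proof.
move=> uv; apply/eqP; rewrite -subr_eq0 -(dnorm_eq0 inner) linearBr/=.
by rewrite uv subrr.
Qed.

Lemma cvg_innerl (w : nat -> H) u v : w @ \oo --> u ->
  (inner (w n) v : C^o) @[n --> \oo] --> (inner u v : C^o).
Proof.
apply: (@lipschitz_cvg _ _ C^o (fun x => inner x v) (nrm v)) => x y.
by rewrite mulrC -linearBl/= nrm_inner_le.
Qed.


End InnerProduct.

(** * Norm and coordinates in [ell2] *)

Section Ell2.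
Context (R : realType).
Local Notation C := R[i].
Implicit Types a b : ell2 R.

Lemma is_cvg_ell2_sqr a : cvgn (series (fun n => nrm (a n : C) ^+ 2)).
Proof. by have /asboolP := ell2_sqsummable a. Qed.

(** The squared norm is a limit of complex partial sums whose imaginary parts vanish, hence the
    limit of their real parts. *)
Lemma ell2_nrm a : nrm a ^+ 2 = limn (series (fun n => nrm (a n : C) ^+ 2)).
Proof.
apply: complexI; rewrite -inner_nrm -[LHS]/(ell2_inner a a) /ell2_inner.
apply: (@cvg_lim C^o); first exact: norm_hausdorff.
rewrite series_Complex; apply: cvg_Complex.
  rewrite [X in X @ _ --> _](_ : _ = series (fun n => nrm (a n : C) ^+ 2)).
    exact: is_cvg_ell2_sqr.
  by congr series; apply/funext => k; rewrite -normCK -nrmC -rmorphXn.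
rewrite [X in X @ _ --> _](_ : _ = fun=> 0); first exact: cvg_cst.
apply/funext => k; rewrite /series/= big1// => i _.
by rewrite -normCK -nrmC -rmorphXn.
Qed.

Lemma ell2_sum_le a (m n : nat) :
  \sum_(m <= k < n) nrm (a k : C) ^+ 2 <= nrm a ^+ 2.
Proof.
rewrite ell2_nrm.
apply: (@le_trans _ _ (series (fun k => nrm (a k : C) ^+ 2) n)).
  have [mn|/ltnW nm] := leqP m n; last first.
    by rewrite big_geq// sumr_ge0// => k _; rewrite sqr_ge0.
  rewrite /series/= (big_cat_nat (leq0n m) mn)/= lerDr.
  by rewrite sumr_ge0// => k _; rewrite sqr_ge0.
apply: nondecreasing_cvgn_le; last exact: is_cvg_ell2_sqr.
by apply: nondecreasing_series => k _ _; rewrite sqr_ge0.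
Qed.

Lemma inner_delta a n : inner a (delta n) = a n.
Proof.
rewrite -[LHS]/(ell2_inner a (delta n)) /ell2_inner.
apply: (@cvg_lim C^o); first exact: norm_hausdorff.
(* Partial sums with at least n + 1 terms include the index n, the only one that contributes, so
   they are constant. *)
apply: cvg_near_cst; exists n.+1 => //= m /= nm.
rewrite /series/= big_mkord (bigD1 (Ordinal nm))//= eqxx conjC1 mulr1.
rewrite big1 ?addr0// => k kn; rewrite (_ : (k == n :> nat) = false).
  by rewrite conjC0 mulr0.
by apply: contra_neqF kn => /eqP kn; exact: val_inj.
Qed.

End Ell2.

(** * Analysis operator U and synthesis operator T of a Bessel sequence *)

Section Bessel.
Context (R : realType) (H : hilbertType R).
Local Notation C := R[i].
Context (Phi : nat -> H) (besselPhi : bessel Phi).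

(** Turns the frame and Bessel conditions, stated in the extended reals, into real bounds on |U
    f|^2. *)
Lemma coef_sqsum_analysis (f : H) :
  coef_sqsum Phi f = (nrm (analysis Phi f) ^+ 2)%:E.
Proof.
rewrite ell2_nrm -EFin_lim; last exact: is_cvg_ell2_sqr.
rewrite /coef_sqsum; congr (limn _); apply/funext => n.
rewrite /series/= -sumEFin; apply: eq_bigr => k _.
by rewrite analysisE.
Qed.

Lemma bessel_analysis_le :
  exists2 M : R, 0 < M & forall f, nrm (analysis Phi f) ^+ 2 <= M * nrm f ^+ 2.
Proof.
have [M M0 bM] := besselPhi; exists M => // f.
by rewrite -lee_fin -coef_sqsum_analysis.
Qed.

Lemma analysis_linear : linear (analysis Phi).
Proof.
move=> k f g; apply/val_inj/funext => n /=.
rewrite -[RHS]/(k * analysis Phi f n + analysis Phi g n).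
by rewrite !analysisE// linearPl.
Qed.

(** The bound for T on finite blocks, from which its series is shown to converge. For the block g,
    expand |g|^2 as the sum of c_k <Phi k, g> and apply Young's inequality to each term. *)
Lemma bessel_sum_le (M : R) (c : nat -> C) (m n : nat) : 0 < M ->
  (forall f, nrm (analysis Phi f) ^+ 2 <= M * nrm f ^+ 2) ->
  nrm (\sum_(m <= k < n) c k *: Phi k) ^+ 2 <=
  M * \sum_(m <= k < n) nrm (c k) ^+ 2.
Proof.
move=> M0 UM; set g := \sum_(_ <= _ < _) _.
have Ug : \sum_(m <= k < n) nrm (inner g (Phi k)) ^+ 2 <= M * nrm g ^+ 2.
  apply: le_trans (UM g); apply: le_trans (ell2_sum_le _ m n).
  by apply: ler_sum => k _; rewrite analysisE.
(* With these weights the Bessel bound makes the second sum at most |g|^2 / 2, which the left side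
   absorbs. *)
have gM : nrm g ^+ 2 <=
    \sum_(m <= k < n) (M / 2 * nrm (c k) ^+ 2
                       + (2 * M)^-1 * nrm (inner g (Phi k)) ^+ 2).
  rewrite -[nrm g ^+ 2]ger0_norm ?sqr_ge0// -nrm_realC -inner_nrm {1}/g.
  rewrite linear_sumlz/=.
  apply: le_trans (nrm_sum _ _ _) _; apply: ler_sum => k _.
  rewrite linearZl_LR/= nrmM inner_conj nrm_conj.
  move: (nrm (c k)) (nrm (inner g (Phi k))) => x y; rewrite -subr_ge0.
  rewrite (_ : _ - _ = (2 * M)^-1 * (M * x - y) ^+ 2).
    by rewrite mulr_ge0 ?sqr_ge0 ?invr_ge0 ?mulr_ge0 ?ltW.
  by field; rewrite gt_eqF.
rewrite big_split/= -!mulr_sumr in gM.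
have := ler_wpM2l (_ : 0 <= (2 * M)^-1) Ug.
rewrite invr_ge0 mulr_ge0 ?(ltW M0)// => /(_ isT).
rewrite (_ : (2 * M)^-1 * (M * nrm g ^+ 2) = nrm g ^+ 2 / 2); last first.
  by field; rewrite gt_eqF.
lra.
Qed.

Lemma is_cvg_synthesis (c : ell2 R) : cvgn (series (fun n => c n *: Phi n)).
Proof.
have [M M0 UM] := bessel_analysis_le.
apply: (@series_exp_le_cvg _ _ 2 M _ _ _ M0 _ (@is_cvg_ell2_sqr _ c)) => // m n.
exact: bessel_sum_le.
Qed.

Arguments is_cvg_synthesis c : clear implicits.

Lemma synthesis_linear : linear (synthesis Phi).
Proof.
move=> k c d; rewrite /synthesis -lim_series_linear;
  [|exact: is_cvg_synthesis..].
congr (limn (series _)); apply/funext => n /=.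
by rewrite scalerDl scalerA.
Qed.

(** T is the adjoint of U: continuity of <., f> carries it through the series of T c, term by
    term. *)
Lemma inner_synthesis (c : ell2 R) (f : H) :
  inner (synthesis Phi c) f = inner c (analysis Phi f).
Proof.
rewrite -[RHS]/(ell2_inner c (analysis Phi f)) /ell2_inner.
apply/esym/(@cvg_lim C^o); first exact: norm_hausdorff.
have := @cvg_innerl _ _ _ _ f (is_cvg_synthesis c).
rewrite (_ : (fun n => _) =
  series (fun n => c n * (analysis Phi f n)^* : C^o))//.
apply/funext => n; rewrite /series/= linear_sumlz/=.
by apply: eq_bigr => k _; rewrite linearZl_LR/= analysisE// -inner_conj.
Qed.

(** Put x = |T c|, y = |c|, z = |U T c|. Then x^2 <= y z by Cauchy-Schwarz and z^2 <= M x^2, while 2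
    y z <= M y^2 + z^2 / M. *)
Lemma nrm_synthesis_le (M : R) (c : ell2 R) : 0 < M ->
  (forall f, nrm (analysis Phi f) ^+ 2 <= M * nrm f ^+ 2) ->
  nrm (synthesis Phi c) ^+ 2 <= M * nrm c ^+ 2.
Proof.
move=> M0 UM; have := UM (synthesis Phi c).
have := nrm_inner_le c (analysis Phi (synthesis Phi c)).
rewrite -inner_synthesis inner_nrm nrm_realC ger0_norm ?sqr_ge0//.
move: (nrm (analysis _ _)) (nrm (synthesis _ _)) (nrm c) => z x y xyz zx.
have : 0 <= M^-1 * (M * y - z) ^+ 2 by rewrite mulr_ge0 ?sqr_ge0 ?invr_ge0 ?ltW.
rewrite (_ : M^-1 * _ = M * y ^+ 2 - 2 * (y * z) + M^-1 * z ^+ 2); last first.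
  by field; rewrite gt_eqF.
have : M^-1 * z ^+ 2 <= x ^+ 2 by rewrite mulrC ler_pdivrMr// mulrC.
lra.
Qed.

End Bessel.

(** Names the S^-1 inside [canonical_dual], so that [canonical_dual Phi n] is
    [frame_op_inv Phi (Phi n)] by conversion. *)
Definition frame_op_inv (R : realType) (H : hilbertType R) (Phi : nat -> H) :
  H -> H := 'pinv_(fun=> 0) [set: H] (frame_op Phi).

(** * The frame operator S = T U and its inverse *)

Section Frame.
Context (R : realType) (H : hilbertType R).
Local Notation C := R[i].
Context (Phi : nat -> H) (framePhi : frame Phi).

Lemma frame_bessel : bessel Phi.
Proof.
by have [m [M [_ M0 mM]]] := framePhi; exists M => // f; have /andP[] := mM f.
Qed.
Local Hint Resolve frame_bessel : core.

(** The upper bound is enlarged to [m + M]: on the zero space the given bounds need not be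
    ordered. *)
Lemma frame_analysis_bounds : exists m M : R, [/\ 0 < m, m < M &
  forall f, m * nrm f ^+ 2 <= nrm (analysis Phi f) ^+ 2 <= M * nrm f ^+ 2].
Proof.
have [m [M [m0 M0 mM]]] := framePhi; exists m, (m + M); split => //.
  by rewrite ltrDl.
move=> f; have := mM f; rewrite coef_sqsum_analysis// !lee_fin => /andP[-> fM].
by rewrite (le_trans fM)// ler_wpM2r ?sqr_ge0// lerDr ltW.
Qed.

Lemma frame_op_linear : linear (frame_op Phi).
Proof.
by move=> k f g; rewrite /frame_op/= analysis_linear// synthesis_linear.
Qed.

HB.instance Definition _ := GRing.isLinear.Build C H H *:%R (frame_op Phi)
  frame_op_linear.

Lemma inner_frame_op (f g : H) :
  inner (frame_op Phi f) g = inner (analysis Phi f) (analysis Phi g).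
Proof. exact: inner_synthesis. Qed.

Lemma inner_frame_opC (f g : H) :
  inner (frame_op Phi f) g = inner f (frame_op Phi g).
Proof.
by rewrite inner_frame_op inner_conj -inner_frame_op -inner_conj.
Qed.

(** Divide m |f|^2 <= |U f|^2 = <S f, f> <= |S f| |f| by |f|. *)
Lemma frame_op_ge : exists2 m : R, 0 < m &
  forall f, m * nrm f <= nrm (frame_op Phi f).
Proof.
have [m [M [m0 _ mM]]] := frame_analysis_bounds; exists m => // f.
have [->|f0] := eqVneq f 0; first by rewrite nrm0 mulr0 nrm_ge0.
have {}f0 : 0 < nrm f by rewrite lt0r nrm_eq0 f0 nrm_ge0.
rewrite -(ler_pM2r f0) -mulrA -expr2.
have /andP[/le_trans-> //] := mM f.
rewrite -[leLHS]ger0_norm ?sqr_ge0// -nrm_realC -inner_nrm -inner_frame_op.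
exact: nrm_inner_le.
Qed.

Lemma frame_op_inj : injective (frame_op Phi).
Proof.
move=> f g fg; apply/eqP; rewrite -subr_eq0 -nrm_eq0.
have [m m0 /(_ (f - g))] := frame_op_ge.
rewrite linearB/= fg subrr nrm0 pmulr_rle0// => fg0.
by rewrite eq_le fg0 nrm_ge0.
Qed.

(* With bounds m < M, the operator 1 - tS for t = m / M ^ 2 satisfies
   |f - tSf|^2 <= (1 - 2tm + t^2 M^2) |f|^2 = (1 - (m / M)^2) |f|^2. *)
Lemma frame_op_surj (g : H) : exists f, frame_op Phi f = g.
Proof.
have [m [M [m0 ltmM mM]]] := frame_analysis_bounds.
have M0 : 0 < M := lt_trans m0 ltmM.
pose t := m / M ^+ 2; have t0 : 0 < t by rewrite divr_gt0 ?exprn_gt0.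
pose T f := f - ((t%:C)%C : C) *: frame_op Phi f.
have linT : linear T.
  move=> k f h; rewrite /T linearP scalerBr scalerDr opprD !scalerA mulrC.
  by rewrite addrACA.
pose r := (m / M) ^+ 2.
have r0 : 0 <= r by rewrite sqr_ge0.
have r1 : r <= 1.
  by rewrite exprn_ile1 ?divr_ge0 ?ler_pdivrMr ?mul1r ?ltW.
pose TL : {linear H -> H} := HB.pack T (GRing.isLinear.Build C H H *:%R T linT).
(* The ratio 1 - r/2 dominates the square root of 1 - r. The target is t g because f - T f = t S
   f. *)
have [||f|f Tf] := @sub_contraction_surj _ _ TL (1 - r / 2) _ _ _
  (((t%:C)%C : C) *: g).
- lra.
- have : 0 < r by rewrite exprn_gt0 ?divr_gt0.
  lra.
- rewrite -(@ler_pXn2r _ 2) ?nnegrE ?mulr_ge0 ?nrm_ge0//; last lra.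
  have US : complex.Re (inner f (frame_op Phi f)) = nrm (analysis Phi f) ^+ 2.
    by rewrite -inner_frame_opC inner_frame_op inner_nrm.
  rewrite /TL/= /T nrmD_sqr nrmN linearNr/= linearZr_LR/= nrmZ nrm_realC.
  have -> : ((t%:C)%C : C)^* = (t%:C)%C := conjc_real t.
  rewrite (gtr0_norm t0).
  rewrite (_ : complex.Re _ = - (t * nrm (analysis Phi f) ^+ 2)); last first.
    by rewrite -US raddfN/=; case: (inner f _) => a b /=; rewrite mul0r subr0.
  have /andP[mU UM] := mM f.
  have SM : nrm (frame_op Phi f) ^+ 2 <= M * nrm (analysis Phi f) ^+ 2.
    by apply: nrm_synthesis_le => // h; have /andP[] := mM h.
  have tm : t * m = r by rewrite /t /r; field; rewrite gt_eqF.
  have tM : t * M ^+ 2 = m by rewrite /t divfK// gt_eqF// exprn_gt0.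
  rewrite [(t * _) ^+ 2]exprMn [leRHS]exprMn.
  have := sqr_ge0 (nrm f); move: SM mU UM.
  move: (nrm f ^+ 2) (nrm _ ^+ 2) (nrm _ ^+ 2) => a b c cM bm bM a0.
  (* Here a = |f|^2, b = |U f|^2, c = |S f|^2. The square to bound is a + t^2 c - 2 t b, at most a -
     r a by this and the next estimate. *)
  have c_le : t ^+ 2 * c <= r * a.
    apply: (@le_trans _ _ (t ^+ 2 * (M * (M * a)))); last first.
      by rewrite -tm -tM le_eqVlt; apply/orP; left; apply/eqP; ring.
    by rewrite ler_wpM2l ?sqr_ge0// (le_trans cM)// ler_wpM2l// ltW.
  have b_ge : r * a <= t * b by rewrite -tm -mulrA ler_wpM2l// ltW.
  have : 0 <= r ^+ 2 * a by rewrite mulr_ge0// sqr_ge0.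
  have -> : (1 - r / 2) ^+ 2 * a = a - r * a + r ^+ 2 * a / 4 by field.
  lra.
exists f; move: Tf; rewrite /TL/= /T opprB addrC subrK.
by apply: scalerI; rewrite gt_eqF ?ltcR.
Qed.

Lemma frame_op_invK : cancel (frame_op_inv Phi) (frame_op Phi).
Proof.
move=> g; apply: pinvK; rewrite inE/=.
by have [f fg] := frame_op_surj g; exists f.
Qed.

Lemma frame_op_inv_linear : linear (frame_op_inv Phi).
Proof.
by move=> k f g; apply: frame_op_inj; rewrite linearP/= !frame_op_invK.
Qed.

Lemma inner_frame_op_inv (f g : H) :
  inner (frame_op_inv Phi f) g = inner f (frame_op_inv Phi g).
Proof.
by rewrite -{1}(frame_op_invK g) -inner_frame_opC frame_op_invK.
Qed.

Lemma frame_op_inv_le :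
  exists2 K : R, 0 <= K & forall f, nrm (frame_op_inv Phi f) <= K * nrm f.
Proof.
have [m m0 mS] := frame_op_ge; exists m^-1; first by rewrite invr_ge0 ltW.
move=> f; rewrite mulrC ler_pdivlMr// mulrC.
by rewrite (le_trans (mS _))// frame_op_invK.
Qed.

(** * Riesz representation through the frame *)

Section Riesz.
Context (l : {linear H -> C^o}) (K : R).
Hypothesis l_le : forall x, nrm (l x : C) <= K * nrm x.

(** Testing l on g, the sum of conj(l(Phi k)) Phi k over k < n, gives l(g) = s, the partial sum.
    Hence s^2 <= K^2 |g|^2 <= K^2 M s, so s <= K^2 M. *)
Lemma functional_frame_sqsummable :
  (fun n => (l (Phi n))^* : C^o) \in @sqsummable R.
Proof.
have [M M0 UM] := bessel_analysis_le frame_bessel.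
apply/asboolP/(nondecreasing_is_cvgn (nondecreasing_series _)) => [k _ _|].
  exact: sqr_ge0.
exists (K ^+ 2 * M) => _ [n _ <-].
set s := (X in X <= _).
pose g := \sum_(0 <= k < n) ((l (Phi k))^* : C) *: Phi k.
have s0 : 0 <= s by rewrite sumr_ge0// => k _; rewrite sqr_ge0.
have lg : s = nrm (l g : C).
  rewrite -[LHS]ger0_norm// -nrm_realC; congr nrm.
  rewrite rmorph_sum/= linear_sum; apply: eq_bigr => k _.
  by rewrite linearZ/= rmorphXn/= nrmC norm_conjC normCK mulrC.
have gM : nrm g ^+ 2 <= M * s.
  exact: (bessel_sum_le frame_bessel _ _ _ M0 UM).
have sg : s ^+ 2 <= K ^+ 2 * nrm g ^+ 2.
  rewrite -exprMn ler_pXn2r ?nnegrE// ?lg//.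
  by rewrite (le_trans _ (l_le g))// nrm_ge0.
have [->|s_neq0] := eqVneq s 0; first by rewrite mulr_ge0 ?sqr_ge0 ?ltW.
rewrite -(@ler_pM2r _ s) ?lt0r ?s_neq0// -expr2 (le_trans sg)//.
by rewrite -[leRHS]mulrA ler_wpM2l ?sqr_ge0.
Qed.

(* u = S^-1 T c with c_n the conjugate of l(Phi n), since
   l(S x) = sum_n <x, Phi n> l(Phi n) = <x, T c>. *)
Lemma frame_riesz : exists u, forall x, l x = inner x u :> C.
Proof.
pose c := Ell2 functional_frame_sqsummable.
exists (frame_op_inv Phi (synthesis Phi c)) => x.
rewrite -inner_frame_op_inv -{1}(frame_op_invK x).
(* From here [x] stands for the former S^-1 x, and the claim reads l(S x) = <x, T c>. *)
move: (frame_op_inv Phi x) => {}x.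
rewrite [RHS]inner_conj inner_synthesis// -inner_conj.
rewrite -[RHS]/(ell2_inner (analysis Phi x) c) /ell2_inner.
apply/esym/(@cvg_lim C^o); first exact: norm_hausdorff.
have llip y z : nrm (l y - l z : C^o) <= K * nrm (y - z) by rewrite -linearB.
have := @is_cvg_synthesis _ _ _ frame_bessel (analysis Phi x).
move=> /(lipschitz_cvg llip).
rewrite (_ : (fun n => _) =
  series (fun n => analysis Phi x n * (c n)^* : C^o))//.
apply/funext => n; rewrite /series/= linear_sum/=.
by apply: eq_bigr => k _; rewrite linearZ/= conjCK.
Qed.

End Riesz.

(** * Adjoints of bounded operators on H *)

Section Adjoint.
Context (V : preHilbertType R) (T : {linear H -> V}) (boundedT : bounded_op T).

(** [adjoint] is an [xget] with default 0, so a representing vector must be exhibited: [frame_riesz]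
    gives one for x -> <T x, v>, which Cauchy-Schwarz bounds by M |v|. *)
Lemma inner_adjoint (x : H) (v : V) : inner (T x) v = inner x (adjoint T v).
Proof.
pose l x : C^o := inner (T x) v.
have linl : linear l by move=> k y z; rewrite /l linearP linearPl.
pose L : {linear H -> C^o} :=
  HB.pack l (GRing.isLinear.Build C H C^o *:%R l linl).
have [M TM] := boundedT.
have [|u lu] := @frame_riesz L (M * nrm v).
  move=> y; rewrite (le_trans (nrm_inner_le _ _))// mulrAC.
  by rewrite ler_wpM2r ?nrm_ge0.
have := xgetPex 0 (ex_intro [set u | forall x, inner (T x) v = inner x u] u lu).
exact.
Qed.

Lemma adjoint_unique (v : V) (u : H) :
  (forall x, inner (T x) v = inner x u) -> adjoint T v = u.
Proof. by move=> Tu; apply: inner_inj => x; rewrite -inner_adjoint. Qed.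

End Adjoint.

End Frame.

Theorem theorem2p5 (R : realType) (H : hilbertType R) (sepH : separable H)
    (Phi : nat -> H) (framePhi : frame Phi)
    (A : {linear H -> H}) (boundedA : bounded_op A)
    (A_near_id : (opnorm (fun f : H => f - A f)%R < 1)%E)
    (Phiad : nat -> H) (besselPhiad : bessel Phiad) :
  (approx_dual Phi Phiad /\
   forall f : H, synthesis Phi (analysis Phiad f) = A f)
  <->
  (exists2 Theta : {linear H -> ell2 R}, ran_synthesis Phi Theta &
   forall n : nat,
     Phiad n = adjoint A (canonical_dual Phi n) + adjoint Theta (delta n)).
Proof.
have besselPhi := frame_bessel framePhi.
pose G := frame_op_inv Phi.
pose D f := analysis Phi (G (A f)).
have synD f : synthesis Phi (D f) = A f by exact: frame_op_invK.
(* S^-1 is self-adjoint: <S^-1 A f, Phi n> = <A f, S^-1 Phi n>. *)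
have inner_D f n : D f n = inner f (adjoint A (canonical_dual Phi n)).
  by rewrite analysisE// -(inner_adjoint framePhi)// inner_frame_op_inv.
have syn_linear := synthesis_linear besselPhi.
split=> [[_ synA] | [ Theta [boundedTheta synTheta] PhiadE]]; last first.
  (* The formula for [Phiad], read coordinatewise; applying T then leaves only T D = A. *)
  have UPhiad f : analysis Phiad f = D f + Theta f.
    apply/val_inj/funext => n /=.
    rewrite -[RHS]/(D f n + Theta f n) analysisE// PhiadE linearDr/= -inner_D.
    by rewrite -(inner_adjoint framePhi)// inner_delta.
  have synA f : synthesis Phi (analysis Phiad f) = A f.
    by rewrite UPhiad -[D f]scale1r syn_linear synTheta addr0 scale1r synD.
  split=> //; split=> //; left.
  (* Once T U_Phiad = A, approximate duality is the hypothesis on A. *)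
  by under eq_fun do rewrite synA.
(* The candidate for Theta: the synthesis operator maps both terms to A f, hence the difference to
   0. *)
pose T f := analysis Phiad f - D f.
have linT : linear T.
  move=> k f g; rewrite /T /D linearP /G (frame_op_inv_linear framePhi).
  by rewrite !analysis_linear// scalerBr opprD addrACA.
pose Theta : {linear H -> ell2 R} :=
  HB.pack T (GRing.isLinear.Build R[i] H (ell2 R) *:%R T linT).
have boundedTheta : bounded_op Theta.
  have [M1 M10 UM1] := bessel_analysis_le besselPhiad.
  have [M2 M20 UM2] := bessel_analysis_le besselPhi.
  have [K K0 GK] := frame_op_inv_le framePhi.
  have [L AL] := boundedA.
  have sq (Psi : nat -> H) M f : 0 < M ->
      nrm (analysis Psi f) ^+ 2 <= M * nrm f ^+ 2 ->
      nrm (analysis Psi f) <= Num.sqrt M * nrm f.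
    move=> M0 UM; rewrite -(@ler_pXn2r _ 2) ?nnegrE ?mulr_ge0 ?nrm_ge0//.
    by rewrite exprMn sqr_sqrtr// ltW.
  exists (Num.sqrt M1 + Num.sqrt M2 * (K * L)) => f.
  rewrite /Theta/= /T (le_trans (nrmD _ _))// nrmN mulrDl lerD ?sq//.
  rewrite (le_trans (sq _ _ _ M20 (UM2 _)))// -mulrA ler_wpM2l//.
  by rewrite (le_trans (GK _))// -mulrA ler_wpM2l.
exists Theta.
  split=> // f; rewrite /Theta/= /T addrC -scaleN1r syn_linear synD synA.
  by rewrite scaleN1r addNr.
(* Theta^* delta_n is identified by uniqueness: <Theta x, delta_n> is the n-th coordinate of Theta
   x. *)
move=> n; apply/eqP; rewrite addrC -subr_eq; apply/eqP/esym.
apply: (adjoint_unique framePhi) => // x.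
rewrite inner_delta -[LHS]/(analysis Phiad x n - D x n) analysisE//.
by rewrite inner_D linearBr.
Qed.
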